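(* Let $n\ge1$, $k\ge1$, $m\ge0$, $q\ge1$ be integers. For $(t,\eta_1,\dots,\eta_n)\in\mathbb{P}^{n+1}$ let $$f_{m,k}(t,\eta_1,\dots,\eta_n)=\sum_{\deg Y\le k-1}\sum_{\deg Z\le m}E(tYZ)\prod_{j=1}^{n}\sum_{\deg U_j\le 0}E(\eta_jYU_j).$$ Writing $t=\sum_{i\ge1}\alpha_iT^{-i}$ and $\eta_j=\sum_{i\ge1}\beta_{ji}T^{-i}$, we have $$f_{m,k}(t,\eta_1,\dots,\eta_n)=2^{k+m+n+1-r(D^{[n;1+m]\times k}(t,\eta_1,\dots,\eta_n))},$$ where $D^{[n;1+m]\times k}(t,\eta_1,\dots,\eta_n)$ is the $(1+n+m)\times k$ matrix whose first $1+m$ rows are $(\alpha_{i+j-1})_{1\le i\le 1+m,1\le j\le k}$ and whose last $n$ rows are $(\beta_{j1},\dots,\beta_{jk})$, $j=1,\dots,n$. Furthermore, let $R_q(n,k,m)$ be the number of tuples $(Y_i,Z_i,U_1^{(i)},\dots,U_n^{(i)})_{1\le i\le q}$ of polynomials in $\mathbb{F}_2[T]$ with $\deg Y_i\le k-1$, $\deg Z_i\le m$, $\deg U_j^{(i)}\le 0$ satisfying $$\sum_{i=1}^qY_iZ_i=0,\qquad \sum_{i=1}^qY_iU_j^{(i)}=0\ (1\le j\le n).$$ Then $$R_q(n,k,m)=\int_{\mathbb{P}^{n+1}}f_{m,k}^q\,dt\,d\eta_1\cdots d\eta_n=2^{q(k+m+n+1)-(n+1)k-m}\sum_{i=0}^{\min(k,n+1+m)}\Gamma_i^{[n;1+m]\times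 k}2^{-iq}.$$
   Context: $\mathbb{K}=\mathbb{F}_2((T^{-1}))$; $\mathbb{P}=\{\sum_{i\ge1}\alpha_iT^{-i}\}$ is the unit interval of $\mathbb{K}$, with Haar measure normalized to total mass $1$ (product measure on $\mathbb{P}^{n+1}$). $E(t)=(-1)^{\alpha_1}$, $\alpha_1$ the coefficient of $T^{-1}$. Degree bounds include the zero polynomial. $r$ is rank over $\mathbb{F}_2$. $\Gamma_i^{[n;1+m]\times k}$ is the number of $(1+m+n)\times k$ matrices $\left[\begin{smallmatrix}A\\ B\end{smallmatrix}\right]$ over $\mathbb{F}_2$ of rank $i$ with $A$ a $(1+m)\times k$ persymmetric matrix $(\alpha_{i+j-1})$ and $B$ an arbitrary $n\times k$ matrix. *)

(* Defs.v *)
From HB Require Import structures.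
From mathcomp Require Import all_boot all_order all_algebra qpoly.
From mathcomp Require Import all_classical all_reals all_analysis.
From mathcomp Require Import zify.
Set Implicit Arguments.
Unset Strict Implicit.
Unset Printing Implicit Defensive.
Import Order.TTheory GRing.Theory Num.Theory.
Local Open Scope classical_set_scope.
Local Open Scope ring_scope.

(* F_2((T^{-1})): [coefK x i] is the coefficient of T^i, and the positive powers
   of T that occur are bounded. *)
Record laurent := Laurent {
  coefK :> int -> 'F_2 ;
  coefK_bounded : exists N : int, forall i, N < i -> coefK i = 0 }.

Lemma mulK_bounded (x y : laurent) : exists N : int, forall d, N < d ->
  \sum_(i \in [set: int]) x i * y (d - i) = 0.
Proof.
have [[Nx hx] [Ny hy]] := (coefK_bounded x, coefK_bounded y).
exists (Nx + Ny) => d hd; rewrite fsbig1// => i _.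
have [ix|xi] := leP i Nx; last by rewrite hx // mul0r.
by rewrite hy ?mulr0 // ltrBrDl (le_lt_trans _ hd)// lerD2r.
Qed.

(* The sum in [mulK] is over all of Z but has finite support. *)
Lemma mulK_finite_support (x y : laurent) (d : int) :
  finite_set [set i : int | x i * y (d - i) != 0].
Proof.
have [[Nx hx] [Ny hy]] := (coefK_bounded x, coefK_bounded y).
have [hle|hlt] := leP (d - Ny) Nx; last first.
  rewrite (_ : mkset _ = set0)//; apply/seteqP; split=> // i /=.
  have [ix|xi] := leP i Nx; last by rewrite hx // mul0r eqxx.
  by rewrite hy ?mulr0 ?eqxx// ltrBrDl -ltrBrDr (le_lt_trans ix hlt).
apply: (sub_finite_set _ (finite_image (fun n : nat => d - Ny + n%:Z)
  (finite_II (absz (Nx - (d - Ny))%R).+1))) => i /=.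
  have [ix|xi] := leP i Nx; last by rewrite hx // mul0r eqxx.
  have [iy|yi] := leP (d - Ny) i; last first.
    by rewrite hy ?mulr0 ?eqxx// ltrBrDl -ltrBrDr.
  move=> _; exists (absz (i - (d - Ny))%R).
    by rewrite ltnS -lez_nat !gez0_abs ?subr_ge0// lerD2r.
  by rewrite gez0_abs ?subr_ge0// addrC subrK.
Qed.

Definition mulK (x y : laurent) : laurent := Laurent (mulK_bounded x y).

Lemma poly_bounded (p : {poly 'F_2}) : exists N : int, forall i, N < i ->
  (if i is Posz n then p`_n else 0) = 0.
Proof. by exists (size p)%:Z => -[n|//] hn; rewrite nth_default// ltnW. Qed.

Definition laurent_of_poly (p : {poly 'F_2}) : laurent :=
  Laurent (poly_bounded p).

(* The unit interval; [t i] is the coefficient of T^{-(i+1)}, so alpha_i of the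
   source is [t i.-1]. *)
Definition unitP := nat -> 'F_2.

HB.instance Definition _ := Choice.on unitP.
HB.instance Definition _ := isPointed.Build unitP (fun=> 0).

Lemma unitP_bounded (t : unitP) : exists N : int, forall i, N < i ->
  (if i is Negz n then t n else 0) = 0.
Proof. by exists 0 => -[]. Qed.

(* [Negz n] is -(n+1). *)
Definition laurent_of_unitP (t : unitP) : laurent := Laurent (unitP_bounded t).

Definition E (R : realType) (x : laurent) : R := (-1) ^+ (x (-1)).

(* Open sets for the absolute value |x| = 2^{deg x}. *)
Definition open_unitP (U : set unitP) : Prop :=
  forall x, U x -> exists N : nat, forall y : unitP,
    (forall i, (i < N)%N -> y i = x i) -> U y.

HB.instance Definition _ :=
  Measurable.copy unitP (g_sigma_algebraType open_unitP).

Definition translate (a x : unitP) : unitP := fun i => a i + x i.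

Definition is_haar (R : realType) (mu : probability unitP R) : Prop :=
  forall (a : unitP) (A : set unitP), measurable A ->
    mu [set translate a x | x in A] = mu A.

(* Existence of the normalized Haar measure, as the law of the binary digits of
   a uniform point of [0, 1[. *)
Section haar_exists.

Let cyl (N : nat) (c : nat -> 'F_2) : set unitP :=
  [set x | forall i, (i < N)%N -> x i = c i].

Let G : set (set unitP) := [set A | A = set0 \/ exists N c, A = cyl N c].

Let cyl_open N c : open_unitP (cyl N c).
Proof. by move=> x xc; exists N => y yx i iN; rewrite yx// xc. Qed.

Let measurable_cyl N c : measurable (cyl N c).
Proof. by apply: sub_sigma_algebra; exact: cyl_open. Qed.

Let setIG : setI_closed G.
Proof.
move=> A B [->|[N [c ->]]]; first by rewrite set0I; left.
move=> [->|[M [d ->]]]; first by rewrite setI0; left.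
have [[z [zc zd]]|h] := pselect (exists z, cyl N c z /\ cyl M d z); last first.
  left; apply/seteqP; split=> // z [zc zd].
  by case: h; exists z.
right; exists (maxn N M), z; apply/seteqP; split=> [x [xc xd] i|x xz].
  by rewrite leq_max => /orP[iN|iM]; [rewrite xc ?zc|rewrite xd ?zd].
split=> i iN.
  by rewrite xz ?zc// leq_max iN.
by rewrite xz ?zd// leq_max iN orbT.
Qed.

Let open_sub U : open_unitP U -> <<s G >> U.
Proof.
move=> Uo.
pose F (s : seq 'F_2) : set unitP :=
  if `[< cyl (size s) (nth 0 s) `<=` U >] then cyl (size s) (nth 0 s) else set0.
have -> : U = \bigcup_s F s.
  apply/seteqP; split=> [x /[dup] Ux /Uo[N xN]|x [s _]]; last first.
    by rewrite /F; case: ifPn => // /asboolP; apply.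
  have nthx i : (i < N)%N -> nth 0 (mkseq x N) i = x i by exact: nth_mkseq.
  exists (mkseq x N) => //; rewrite /F size_mkseq ifT.
    by move=> i /= iN; rewrite nthx.
  by apply/asboolP => y yx; apply: xN => i iN; rewrite yx// nthx.
apply: (@countable_bigcupT_measurable _ (g_sigma_algebraType G)).
  exact: countableP.
move=> s; rewrite /F; case: ifP => _; last exact: measurable0.
by apply: sub_sigma_algebra; right; exists (size s), (nth 0 s).
Qed.

Let measurableE : @measurable _ unitP = <<s G >>.
Proof.
apply/seteqP; split.
  by apply: smallest_sub; [exact: smallest_sigma_algebra|exact: open_sub].
apply: smallest_sub; first exact: sigma_algebra_measurable.
by move=> A [->|[N [c ->]]]; [exact: measurable0|exact: measurable_cyl].
Qed.

Let measurable_translate a : measurable_fun setT (translate a).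
Proof.
apply: (measurability _ measurableE) => _ [A + <-]; rewrite setTI.
move=> [->|[N [c ->]]]; first by rewrite preimage_set0; exact: measurable0.
rewrite (_ : _ @^-1` _ = cyl N (fun i => c i - a i)); first exact: measurable_cyl.
apply/seteqP; split=> x /= xc i iN.
  by rewrite -(xc i iN) /translate addrC addKr.
by rewrite /translate (xc i iN) addrC subrK.
Qed.

Variable R : realType.

Let digit (x : measurableTypeR R) : unitP := fun i => (Num.floor (2 ^+ i.+1 * (x : R)))%:~R.

Let dyadic (N : nat) (J : int) : set (measurableTypeR R) :=
  [set x : R | Num.floor (2 ^+ N * x) = J].

Let dyadicE N J : dyadic N J = `[J%:~R / 2 ^+ N, (J + 1)%:~R / 2 ^+ N[%classic.
Proof.
have p2 : (0 : R) < 2 ^+ N by rewrite exprn_gt0.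
apply/seteqP; split=> x /=; rewrite in_itv/=.
  move=> /eqP; rewrite floor_eq => /andP[h1 h2].
  by rewrite ler_pdivrMr// ltr_pdivlMr// mulrC h1 h2.
rewrite ler_pdivrMr// ltr_pdivlMr// mulrC => h.
by apply/eqP; rewrite floor_eq.
Qed.

Let measurable_dyadic N J : measurable (dyadic N J).
Proof. by rewrite dyadicE; exact: measurable_itv. Qed.

Let measurable_digit : measurable_fun [set: measurableTypeR R] digit.
Proof.
apply: (measurability _ measurableE) => _ [A + <-]; rewrite setTI.
move=> [->|[N [c ->]]]; first by rewrite preimage_set0; exact: measurable0.
have -> : digit @^-1` cyl N c = \bigcap_(i in [set i | (i < N)%N])
    \bigcup_J (if J%:~R == c i then dyadic i.+1 J else set0).
  apply/seteqP; split=> x /= xc i /= iN.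
    exists (Num.floor (2 ^+ i.+1 * x)) => //.
    by rewrite -[_%:~R]/(digit x i) xc// eqxx.
  have [J _] := xc i iN; case: ifPn => // /eqP <-.
  by rewrite /dyadic /= /digit => ->.
apply: bigcap_measurableType => i _.
apply: countable_bigcupT_measurable; first exact: countableP.
by move=> J; case: ifP => _; [exact: measurable_dyadic|exact: measurable0].
Qed.

Let index (c : nat -> 'F_2) : nat -> int :=
  fix I N := if N is M.+1 then I M * 2 + (c M : nat)%:Z else 0.

Let floorS N (x : R) : exists b : bool,
  Num.floor (2 ^+ N.+1 * x) = Num.floor (2 ^+ N * x) * 2 + (b : nat)%:Z.
Proof.
rewrite exprS -mulrA; set y := 2 ^+ N * x; set J := Num.floor y.
have /andP[h1 h2] := floor_itv y; rewrite -/J in h1 h2.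
have e2 : (J * 2)%:~R = 2 * J%:~R :> R by rewrite intrM mulrC.
rewrite intrD in h2.
have [h|h] := ltP (2 * y) ((J * 2 + 1)%:~R).
  exists false; rewrite addr0; apply: floor_def; rewrite h andbT e2.
  by rewrite ler_pM2l.
exists true; apply: floor_def; rewrite h /= -addrA intrD e2.
by rewrite (_ : (_ + _)%:~R = 2 * 1%:~R) -?mulrDr ?ltr_pM2l// mulr1.
Qed.

Let bitF2 (b : bool) (e : 'F_2) (J : int) :
  ((J * 2 + (b : nat)%:Z)%:~R == e) = ((b : nat) == e).
Proof.
rewrite intrD intrM (_ : 2%:~R = 0 :> 'F_2); last exact/val_inj.
by rewrite mulr0 add0r; case: b; case: e => -[|[|]].
Qed.

Let cyl_digit N c : `[0, 1[%classic `&` digit @^-1` cyl N c = dyadic N (index c N).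
Proof.
apply/seteqP; elim: N => [|N [IH1 IH2]]; split.
- move=> x [/= + _]; rewrite in_itv/= => /andP[x0 x1].
  by apply: floor_def; rewrite expr0 mul1r x0 add0r.
- move=> x /= /eqP; rewrite expr0 mul1r floor_eq add0r => h.
  by split=> //; rewrite in_itv.
- move=> x [/= x01 xc].
  have /IH1 /= xJ : (`[0, 1[%classic `&` digit @^-1` cyl N c) x.
    by split=> // i iN; apply: xc; rewrite ltnS ltnW.
  have [b hb] := floorS N x.
  have := xc N (ltnSn N); rewrite /digit hb xJ => /eqP.
  by rewrite bitF2 /dyadic/= hb xJ => /eqP ->.
- move=> x; have [b hb] := floorS N x; rewrite /dyadic/= hb => hJ.
  have cN : ((c N : nat) < 2)%N by exact: ltn_ord.
  have [bE JE] : (b : nat) = c N /\ Num.floor (2 ^+ N * x) = index c N.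
    by move: hJ cN; move: (Num.floor _) (index c N) (c N : nat) => u v [|[|w]];
      case: b {hb} => /=; lia.
  have [x01 xc] := IH2 x JE; split=> // i; rewrite ltnS leq_eqVlt.
  move=> /predU1P[->|iN]; last exact: xc.
  by apply/eqP; rewrite /digit hb bitF2 bE.
Qed.

Let lam := mrestr (@lebesgue_measure R) (measurable_itv `[0 : R, 1[).
HB.instance Definition _ := Measure.on lam.

Let lam_cyl N c : lam (digit @^-1` cyl N c) = ((2 ^+ N)^-1)%:E.
Proof.
rewrite /lam /mrestr setIC cyl_digit dyadicE lebesgue_measure_itv/= lte_fin.
rewrite ltr_pM2r ?invr_gt0 ?exprn_gt0// ltr_int ltrDl ltr01 -EFinB.
by rewrite -mulrBl intrD addrAC subrr add0r mul1r.
Qed.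

Let lamT : lam setT = 1%E.
Proof.
by rewrite /lam /mrestr setTI lebesgue_measure_itv/= lte_fin ltr01 sube0.
Qed.

HB.instance Definition _ := Measure_isProbability.Build _ _ _ lam lamT.

HB.instance Definition _ :=
  isMeasurableFun.Build _ _ _ _ digit measurable_digit.

HB.instance Definition _ a :=
  isMeasurableFun.Build _ _ _ _ (translate a) (@measurable_translate a).

Lemma haar_exists : exists mu : probability unitP R, is_haar mu.
Proof.
pose mu : probability unitP R := distribution lam digit.
have mu_cyl N c : mu (cyl N c) = ((2 ^+ N)^-1)%:E by exact: lam_cyl.
exists mu => a A mA; pose na : unitP := fun i => - a i.
have -> : [set translate a x | x in A] = translate na @^-1` A.
  apply/seteqP; split=> [_ [x Ax <-]|x Ax] /=.
    rewrite (_ : translate _ _ = x)//; apply/funext => i.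
    by rewrite /translate /na addKr.
  exists (translate na x) => //; apply/funext => i.
  by rewrite /translate /na addNKr.
apply: (measure_unique G (fun=> setT) measurableE setIG _ _
  (distribution mu (translate na)) mu) => //.
- by move=> _; right; exists 0, (fun=> 0); apply/seteqP; split.
- by rewrite bigcup_const.
- move=> _ [->|[N [c ->]]]; first by rewrite !measure0.
  transitivity (mu (cyl N (fun i => a i + c i))); last first.
    by rewrite mu_cyl; apply/esym; exact: mu_cyl.
  congr (mu _).
  apply/seteqP; split=> x /= xc i iN; rewrite /translate /na.
    by rewrite -(xc i iN) addNKr.
  by rewrite (xc i iN) addKr.
- by move=> _; rewrite -ge0_fin_numE// fin_num_measure.
Qed.

End haar_exists.

Section power_measure.
Context (d : measure_display) (T : measurableType d) (R : realType).

Definition cons_pair (n : nat) (x : T * n.-tuple T) : n.+1.-tuple T :=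
  [the n.+1.-tuple T of x.1 :: x.2].

Lemma measurable_cons_pair n : measurable_fun setT (@cons_pair n).
Proof. exact: measurable_cons. Qed.

HB.instance Definition _ n :=
  isMeasurableFun.Build _ _ _ _ (@cons_pair n) (@measurable_cons_pair n).

Fixpoint power_measure (mu : probability T R) (n : nat) :
    probability (n.-tuple T) R :=
  match n with
  | 0 => dirac [tuple]
  | n'.+1 => distribution (mu \x power_measure mu n')%E (@cons_pair n')
  end.
End power_measure.

Definition fmk (R : realType) (n m k : nat) (t : unitP) (eta : n.-tuple unitP)
    : R :=
  \sum_(Y : {poly_k 'F_2}) \sum_(Z : {poly_(m.+1) 'F_2})
    E R (mulK (laurent_of_unitP t) (laurent_of_poly (val Y * val Z))) *
    \prod_(j < n) \sum_(U : {poly_1 'F_2})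
      E R (mulK (laurent_of_unitP (tnth eta j))
                (laurent_of_poly (val Y * val U))).

(* With 0-based i, j the entry alpha_{i+j-1} is [t (i + j)]. *)
Definition persym (r k : nat) (t : nat -> 'F_2) : 'M['F_2]_(r, k) :=
  \matrix_(i, j) t (i + j)%N.

Definition Dmx (n m k : nat) (t : unitP) (eta : n.-tuple unitP)
    : 'M['F_2]_(1 + m + n, k) :=
  col_mx (persym (1 + m) k t) (\matrix_(j, i) tnth eta j i).

Definition Gamma (n m k i : nat) : nat :=
  #|[set M : 'M['F_2]_(1 + m + n, k) | (\rank M == i) &&
       `[< exists a : nat -> 'F_2, usubmx M = persym (1 + m) k a >]]%SET|.

Definition Rq (q n k m : nat) : nat :=
  #|[set s : {ffun 'I_q -> {poly_k 'F_2} * {poly_(m.+1) 'F_2} *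
                           {ffun 'I_n -> {poly_1 'F_2}}} |
       (\sum_i val (s i).1.1 * val (s i).1.2 == 0) &&
       [forall j, \sum_i val (s i).1.1 * val ((s i).2 j) == 0]]%SET|.

(* Main.v *)
(** For fixed [Y] the inner sums of [f_{m,k}] are sums of additive characters of
    F_2-vector spaces, so they vanish unless the coefficient vector of [Y] lies in
    the kernel of [D], and [f_{m,k}] counts that kernel.  Hence [f_{m,k}] depends
    only on finitely many coefficients; Haar invariance makes all cylinders of a
    given length equally likely, and the integral is a finite average over
    truncations.  Grouping the truncations by the rank of [D] gives the [Gamma_i],
    while expanding [f_{m,k}^q] and applying character orthogonality in the
    truncation variable leaves exactly the solutions counted by [R_q]. *)

Require Import Defs.
From mathcomp Require Import all_boot all_order all_algebra.
From mathcomp Require Import qpoly mxabelem.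
From mathcomp Require Import all_classical all_reals all_analysis.
From mathcomp Require Import measurable_realfun zify.
Set Implicit Arguments.
Unset Strict Implicit.
Unset Printing Implicit Defensive.
Import Order.TTheory GRing.Theory Num.Theory.
Local Open Scope classical_set_scope.
Local Open Scope ring_scope.

(** * Additive characters of F_2 and their orthogonality *)

Definition chi (R : realType) (x : 'F_2) : R := (-1) ^+ x.

Lemma F2_neq0 (x : 'F_2) : x != 0 -> x = 1.
Proof. by case: x => [[|[|//]] ?] // _; apply/val_inj. Qed.

Lemma chi0 (R : realType) : chi R 0 = 1. Proof. exact: expr0. Qed.

Lemma chi1 (R : realType) : chi R 1 = -1. Proof. exact: expr1. Qed.

Lemma chiD (R : realType) : {morph chi R : x y / x + y >-> x * y}.
Proof.
move=> x y; have [->|/F2_neq0 ->] := eqVneq x 0.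
  by rewrite add0r chi0 mul1r.
have [->|/F2_neq0 ->] := eqVneq y 0; first by rewrite addr0 chi0 mulr1.
by rewrite (_ : 1 + 1 = 0) ?chi0 ?chi1 ?mulrNN ?mulr1//; exact/val_inj.
Qed.

Lemma chi_sum (R : realType) (I : finType) (F : I -> 'F_2) :
  chi R (\sum_i F i) = \prod_i chi R (F i).
Proof. exact: (big_morph _ (chiD R) (chi0 R)). Qed.

(** If some weight [w i0] is nonzero, translating the summation variable by ['X^i0] flips the sign
    of every term, so the sum equals its own opposite. *)
Lemma sum_chi_npoly (R : realType) (N : nat) (w : 'I_N -> 'F_2) :
  \sum_(a : {poly_N 'F_2}) chi R (\sum_(i < N) (val a)`_i * w i) =
  if [forall i, w i == 0] then 2 ^+ N else 0.
Proof.
case: ifPn => [/forallP w0|/forallPn[i0 /F2_neq0 wi0]].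
  rewrite (eq_bigr (fun=> 1)) => [|a _]; last first.
    by rewrite big1 ?chi0// => i _; rewrite (eqP (w0 i)) mulr0.
  by rewrite sumr_const card_npoly card_Fp// natrX.
set S := LHS; suff : S = - S.
  by move/eqP; rewrite -subr_eq0 opprK -mulr2n mulrn_eq0 => /eqP.
rewrite {1}/S (reindex_inj (addIr (tnth (npolyX 'F_2 N) i0))) -sumrN; apply: eq_bigr => a _.
have -> : \sum_(i < N) (val (a + tnth (npolyX 'F_2 N) i0))`_i * w i =
    (\sum_(i < N) (val a)`_i * w i) + 1.
  transitivity (\sum_(i < N) (val a)`_i * w i + \sum_(i < N) ('X^i0)`_i * w i).
    rewrite -big_split; apply: eq_bigr => i _.
    by rewrite raddfD/= npolyXE coefD mulrDl.
  congr (_ + _); rewrite (bigD1 i0)//= coefXn eqxx mul1r wi0 big1 ?addr0// => i.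
  by rewrite coefXn => /negPf ii0; rewrite (inj_eq val_inj) ii0 mul0r.
by rewrite chiD chi1 mulrN1.
Qed.

(** * The character E on products, as a pairing of coefficients *)

Lemma E_mulK (R : realType) (N : nat) (t : unitP) (p : {poly 'F_2}) :
  (size p <= N)%N ->
  E R (mulK (laurent_of_unitP t) (laurent_of_poly p)) =
  chi R (\sum_(i < N) t i * p`_i).
Proof.
move=> pN; rewrite /E /chi /= (fsbig_ord _ N (fun i => t i * p`_i)).
congr ((-1) ^+ (nat_of_ord _)).
(* Only the exponents [Negz i] = -(i+1) with i < N contribute: at nonnegative ones [t] has no
   coefficient, and [Negz i] is paired with the coefficient of index i of [p], which vanishes from N
   on. *)
rewrite -(@fsbig_widen _ _ _ _ (Negz @` `I_N)%classic) //=; last first.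
  move=> [i|i] [_ /= h]; first by rewrite mul0r.
  rewrite subn1 /=.
  have [iN|Ni] := ltnP i N; first by case: h; exists i.
  by rewrite nth_default ?mulr0// (leq_trans pN).
rewrite (reindex_fsbig Negz `I_N).
  by apply: eq_fsbigr => i _ /=; rewrite subn1.
split=> [i iN|i j _ _ []//|_ [i iN <-]]; first by exists i.
by exists i.
Qed.

(** The digit [t l] meets exactly the products of coefficients of [Z] and [Y] whose indices add up
    to l; this is where the persymmetric shape comes from. The largest such index is (k-1) + (r-1),
    whence the bound on [N]. *)
Lemma pairing_mul (N k r : nat) (t : nat -> 'F_2) (Y Z : {poly 'F_2}) :
  (size Y <= k)%N -> (size Z <= r)%N -> (k + r <= N.+1)%N ->
  \sum_(l < N) t l * (Y * Z)`_l =
  \sum_(i < r) Z`_i * \sum_(j < k) t (i + j)%N * Y`_j.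
Proof.
move=> Yk Zr krN.
have -> : Y * Z = \sum_(i < r) \sum_(j < k) (Z`_i * Y`_j) *: 'X^(i + j).
  have polyE (p : {poly 'F_2}) d : (size p <= d)%N -> p = \sum_(i < d) p`_i *: 'X^i.
    move=> pd; rewrite -poly_def; apply/polyP => i; rewrite coef_poly.
    by case: ltnP => // di; rewrite nth_default// (leq_trans pd).
  rewrite {1}(polyE Y k)// {1}(polyE Z r)// mulrC mulr_suml.
  apply: eq_bigr => i _; rewrite mulr_sumr; apply: eq_bigr => j _.
  by rewrite -scalerAl -scalerAr scalerA exprD.
under eq_bigr do rewrite coef_sum mulr_sumr.
rewrite exchange_big /=; apply: eq_bigr => i _.
under eq_bigr do rewrite coef_sum mulr_sumr.
rewrite exchange_big mulr_sumr /=; apply: eq_bigr => j _.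
have ijN : (i + j < N)%N.
  by rewrite -ltnS (leq_trans _ krN)// addnC -addSn -addnS leq_add.
rewrite (bigD1 (Ordinal ijN))//= coefZ coefXn eqxx mulr1 big1 ?addr0.
  by rewrite mulrCA.
move=> l /eqP lij; rewrite coefZ coefXn; case: eqP => [e|_]; last by rewrite !mulr0.
by case: lij; exact: val_inj.
Qed.

(** * The kernel of D and the rank formula for f *)

Lemma mulmx_persym_eq0 (k r : nat) (t : nat -> 'F_2) (Y : {poly_k 'F_2}) :
  [forall i : 'I_r, \sum_(j < k) t (i + j)%N * (val Y)`_j == 0] =
  (persym r k t *m (npoly_rV Y)^T == 0).
Proof.
have e (i : 'I_r) : (persym r k t *m (npoly_rV Y)^T) i 0 =
    \sum_(j < k) t (i + j)%N * (val Y)`_j.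
  by rewrite !mxE; apply: eq_bigr => j _; rewrite !mxE.
apply/forallP/eqP => [h|h i]; last by rewrite -e h mxE.
by apply/matrixP => i j; rewrite ord1 e mxE; exact/eqP.
Qed.

(** Orthogonality in [Z], whose weights are the entries of the persymmetric matrix applied to [Y].
    It serves both kinds of inner sum: [r = m.+1] for Z and [r = 1] for each U_j. *)
Lemma sum_E_mul (R : realType) (k r : nat) (t : unitP) (Y : {poly_k 'F_2}) :
  \sum_(Z : {poly_r 'F_2})
    E R (mulK (laurent_of_unitP t) (laurent_of_poly (val Y * val Z))) =
  if persym r k t *m (npoly_rV Y)^T == 0 then 2 ^+ r else 0.
Proof.
rewrite -mulmx_persym_eq0 -sum_chi_npoly; apply: eq_bigr => Z _.
have Yk := size_npoly Y; have Zr := size_npoly Z.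
rewrite (@E_mulK _ (k + r)); last first.
  by rewrite (leq_trans (size_polyMleq _ _))// (leq_trans (leq_pred _))// leq_add.
by rewrite (@pairing_mul _ k r).
Qed.

Lemma card_npoly_ker (r k : nat) (D : 'M['F_2]_(r, k)) :
  #|[set Y : {poly_k 'F_2} | D *m (npoly_rV Y)^T == 0]%SET| =
  (2 ^ (k - \rank D))%N.
Proof.
(* [kermx] is a left kernel, so the right kernel of [D] is reached through the transpose. *)
rewrite -(mxrank_tr D) -mxrank_ker.
have <- : #|rowg (kermx D^T)| = (2 ^ \rank (kermx D^T))%N.
  by rewrite card_rowg card_Fp.
rewrite -(card_imset _ (can_inj (@rVnpolyK _ k))).
apply: eq_card => Y; rewrite inE.
have mem v : (v \in rowg (kermx D^T)) = (D *m v^T == 0).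
  by rewrite mem_rowg sub_kermx -(inj_eq trmx_inj) trmx_mul trmxK trmx0.
apply/idP/imsetP => [h|[v + ->]]; last by rewrite mem rVnpolyK.
by exists (npoly_rV Y); rewrite ?mem ?npoly_rV_K.
Qed.

(** Each lower row of [Dmx] is read as a one-row persymmetric matrix, which puts the kernel
    condition in the form delivered by [sum_E_mul]. *)
Lemma mulmx_Dmx_eq0 (n m k : nat) (t : unitP) (eta : n.-tuple unitP)
    (y : 'cV['F_2]_k) :
  (Dmx m k t eta *m y == 0) = (persym m.+1 k t *m y == 0) &&
    [forall j : 'I_n, persym 1 k (tnth eta j) *m y == 0].
Proof.
rewrite /Dmx mul_col_mx -[X in _ == X]vsubmxK !linear0.
have -> : (col_mx (persym (1 + m) k t *m y) ((\matrix_(j, i) tnth eta j i : 'M['F_2]_(n, k)) *m y) ==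
    col_mx 0 0) = (persym m.+1 k t *m y == 0) &&
    ((\matrix_(j, i) tnth eta j i : 'M['F_2]_(n, k)) *m y == 0).
  by apply/eqP/andP => [/eq_col_mx[-> ->]//|[/eqP h /eqP ->]]; rewrite -h.
congr (_ && _); have e (j : 'I_n) (l i : 'I_1) :
    (persym 1 k (tnth eta j) *m y) l i =
    ((\matrix_(j, i) tnth eta j i : 'M['F_2]_(n, k)) *m y) j i.
  by rewrite !mxE; apply: eq_bigr => s _; rewrite !mxE ord1.
apply/eqP/forallP => [h j|h].
  by apply/eqP/matrixP => l i; rewrite e h !mxE.
by apply/matrixP => j i; rewrite -(e j 0) (eqP (h j)) !mxE.
Qed.

Lemma fmkE (R : realType) (n m k : nat) (t : unitP) (eta : n.-tuple unitP) :
  fmk R m k t eta =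
  2 ^ ((k + m + n + 1)%N%:Z - (\rank (Dmx m k t eta))%:Z).
Proof.
(* For [Y] in the kernel, Z contributes 2^(m+1) and each of the n sums over U_j contributes 2. *)
transitivity (\sum_(Y : {poly_k 'F_2})
    if Dmx m k t eta *m (npoly_rV Y)^T == 0 then 2 ^+ (m.+1 + n) else 0 : R).
  apply: eq_bigr => Y _.
  rewrite -mulr_suml sum_E_mul mulmx_Dmx_eq0.
  under eq_bigr do rewrite sum_E_mul.
  case: ifP => _; last by rewrite mul0r.
  case: ifPn => [/forallP h|/forallPn[j /negPf hj]] /=; last first.
    by rewrite (bigD1 j)//= hj mul0r mulr0.
  under eq_bigr do rewrite h.
  by rewrite prodr_const card_ord expr1 exprD.
rewrite -big_mkcond sumr_const.
have -> : #|[pred Y : {poly_k 'F_2} | Dmx m k t eta *m (npoly_rV Y)^T == 0]| =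
   (2 ^ (k - \rank (Dmx m k t eta)))%N.
  by rewrite -card_npoly_ker cardsE.
rewrite -[LHS]mulr_natr natrX -exprD exprnP; congr (_ ^ _).
have rk := rank_leq_col (Dmx m k t eta).
rewrite subzn; last by rewrite (leq_trans rk)// -!addnA leq_addr.
by congr Posz; lia.
Qed.

(** * Haar measure of cylinders and product measure of boxes *)

Definition cylinder (N : nat) (c : nat -> 'F_2) : set unitP :=
  [set x | forall i, (i < N)%N -> x i = c i].

Lemma measurable_cylinder (N : nat) (c : nat -> 'F_2) :
  measurable (cylinder N c).
Proof.
by apply: sub_sigma_algebra => x xc; exists N => y yx i iN; rewrite yx// xc.
Qed.

(** By induction on [N]: a cylinder of length N splits into two halves according to the digit of
    index N. Translation by the element with that single digit exchanges them, so invariance gives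
    them equal measure. *)
Lemma haar_cylinder (R : realType) (mu : probability unitP R) (N : nat)
    (c : nat -> 'F_2) :
  is_haar mu -> mu (cylinder N c) = ((2 ^+ N)^-1)%:E.
Proof.
move=> mu_haar; elim: N => [|N IH].
  rewrite expr0 invr1 (_ : cylinder 0 c = setT) ?probability_setT//.
  by apply/seteqP; split.
pose e : unitP := fun i => (i == N)%:R.
have F2D (x : 'F_2) : x + x = 0 by case: x => [[|[|//]] ?]; apply/val_inj.
pose A := cylinder N.+1 c; pose B := [set translate e x | x in A].
have BE : B = cylinder N.+1 (translate e c).
  apply/seteqP; split=> [_ [x xA <-] i iN|x xB]; first by rewrite /translate xA.
  exists (translate e x); last by apply/funext => i; rewrite /translate addrA F2D add0r.
  by move=> i iN; rewrite /translate xB// /translate addrA F2D add0r.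
have mB : measurable B by rewrite BE; exact: measurable_cylinder.
have mA : measurable A by exact: measurable_cylinder.
have AB0 : A `&` B = set0.
  rewrite BE; apply/seteqP; split=> // x [xA xB].
  have := xA N (ltnSn N); rewrite (xB N (ltnSn N)) /translate /e eqxx => /eqP.
  by rewrite -{2}[c N]add0r (inj_eq (addIr _)) oner_eq0.
have ABE : cylinder N c = A `|` B.
  rewrite BE; apply/seteqP; split=> [x xc|x [xA|xB] i iN]; last 2 first.
  - by rewrite xA// ltnW.
  - by rewrite xB ?(leqW iN)// /translate /e (ltn_eqF iN) add0r.
  have [xN|xN] := eqVneq (x N) (c N); [left|right] => i; rewrite ltnS leq_eqVlt.
    by move=> /predU1P[->//|]; exact: xc.
  move=> /predU1P[->|iN]; last by rewrite xc// /translate /e (ltn_eqF iN) add0r.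
  rewrite /translate /e eqxx; move: xN.
  by case: (x N) => [[|[|//]] ?]; case: (c N) => [[|[|//]] ?] //= _; apply/val_inj.
have muB : mu B = mu A := mu_haar e A mA.
have muAB : mu (A `|` B) = (mu A + mu A)%E by rewrite -{2}muB; exact: measureU.
have := IH; rewrite ABE muAB.
(* Finiteness brings the doubling equation down to [R], where it can be divided by 2. *)
have : mu A \is a fin_num by exact: fin_num_measure.
rewrite -/A; case: (mu A) => // r _; rewrite -EFinD => -[]; rewrite -mulr2n => h; congr (_%:E).
by rewrite exprS invfM -h -[r *+ 2]mulr_natl mulKf// pnatr_eq0.
Qed.

Lemma measurable_box (d : measure_display) (T : measurableType d) (n : nat)
    (A : 'I_n -> set T) : (forall j, measurable (A j)) ->
  measurable [set x : n.-tuple T | forall j, A j (tnth x j)].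
Proof.
move=> mA.
rewrite (_ : mkset _ = \bigcap_(j in [set: 'I_n]) ((fun x => tnth x j) @^-1` A j)).
  apply: fin_bigcap_measurable => // j _; rewrite -[X in measurable X]setTI.
  exact: measurable_tnth.
by apply/seteqP; split=> x /= h j; [move=> _; exact: h|exact: h].
Qed.

Lemma power_measure_box (d : measure_display) (T : measurableType d)
    (R : realType) (mu : probability T R) (n : nat) (A : 'I_n -> set T) :
  (forall j, measurable (A j)) ->
  power_measure mu n [set x | forall j, A j (tnth x j)] =
  (\prod_(j < n) mu (A j))%E.
Proof.
elim: n A => [|n IH] A mA.
  rewrite big_ord0 /= diracE (_ : _ \in _)//.
  by apply/mem_set => -[].
rewrite big_ord_recl /= /distribution /pushforward.
(* Splitting off the first coordinate turns the box into a rectangle, to which the product measure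
   formula applies. *)
have -> : @cons_pair _ T n @^-1` [set x | forall j, A j (tnth x j)] =
    A ord0 `*` [set x | forall j, A (lift ord0 j) (tnth x j)].
  apply/seteqP; split=> [[x s] /= h|[x s] /= [h1 h2] j].
    split; first exact: (h ord0).
    by move=> j; have := h (lift ord0 j); rewrite tnthS.
  by case: (unliftP ord0 j) => [i|] ->; [rewrite tnthS; exact: h2|exact: h1].
rewrite product_measure1E//; first by congr (_ * _)%E; exact: (IH (fun j => A (lift ord0 j))).
exact: (@measurable_box _ _ n (fun j => A (lift ord0 j))).
Qed.

(** * Truncation to finitely many digits, and integrals as finite averages *)

Definition trunc_npoly (N : nat) (t : unitP) : {poly_N 'F_2} :=
  npolyp N (\poly_(i < N) t i).

Lemma coef_trunc_npoly (N : nat) (t : unitP) (i : nat) :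
  (val (trunc_npoly N t))`_i = if (i < N)%N then t i else 0.
Proof. by rewrite coef_npolyp coef_poly; case: (i < N)%N. Qed.

Lemma trunc_npoly_eq (N : nat) (t : unitP) (a : {poly_N 'F_2}) :
  trunc_npoly N t = a <-> cylinder N (nth 0 (val a)) t.
Proof.
split=> [<- i iN|h]; first by rewrite coef_trunc_npoly iN.
apply/npolyP => i; rewrite coef_trunc_npoly; case: ltnP => [/h//|Ni].
by rewrite big_coef_npoly.
Qed.

(** Digits are stored as polynomials of bounded size, so that the configurations form a finite type
    and sums over them fall under [sum_chi_npoly]. *)
Definition trunc_config (L k n : nat) (x : unitP * n.-tuple unitP) :
    {poly_L 'F_2} * {ffun 'I_n -> {poly_k 'F_2}} :=
  (trunc_npoly L x.1, [ffun j => trunc_npoly k (tnth x.2 j)]).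

Lemma trunc_config_preimage (L k n : nat)
    (c : {poly_L 'F_2} * {ffun 'I_n -> {poly_k 'F_2}}) :
  @trunc_config L k n @^-1` [set c] = cylinder L (nth 0 (val c.1)) `*`
    [set s | forall j, cylinder k (nth 0 (val (c.2 j))) (tnth s j)].
Proof.
apply/seteqP; split=> [[t s] /= <-|[t s] /= [h1 h2]].
  split=> [|j] /=; first exact/trunc_npoly_eq.
  by rewrite ffunE; exact/trunc_npoly_eq.
case: c h1 h2 => a B /= h1 h2; congr (_, _); first by apply/trunc_npoly_eq.
by apply/ffunP => j; rewrite ffunE; apply/trunc_npoly_eq; exact: h2.
Qed.

(** The fibres of [trunc_config] are boxes of equal measure, and the integrand is constant on each.
    Nonnegativity of [G] allows the finite sum to leave the integral. *)
Lemma integral_trunc_config (R : realType) (mu : probability unitP R)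
    (L k n : nat) (G : {poly_L 'F_2} * {ffun 'I_n -> {poly_k 'F_2}} -> R) :
  is_haar mu -> (forall c, 0 <= G c) ->
  (\int[mu \x power_measure mu n]_x (G (trunc_config L k x))%:E =
   ((2 ^+ (L + n * k))^-1 * \sum_c G c)%:E)%E.
Proof.
move=> mu_haar G0; pose A c := @trunc_config L k n @^-1` [set c].
have mbox (c : {poly_L 'F_2} * {ffun 'I_n -> {poly_k 'F_2}}) : measurable
    [set s | forall j, cylinder k (nth 0 (val (c.2 j))) (tnth s j)].
  apply: (@measurable_box _ _ n (fun j => cylinder k (nth 0 (val (c.2 j))))) => j.
  exact: measurable_cylinder.
have mA c : measurable (A c).
  rewrite /A trunc_config_preimage; apply: measurableX => //.
  exact: measurable_cylinder.
have muA c : (mu \x power_measure mu n)%E (A c) = ((2 ^+ (L + n * k))^-1)%:E.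
  rewrite /A trunc_config_preimage product_measure1E//; last first.
    exact: measurable_cylinder.
  transitivity (((2 ^+ L)^-1)%:E * \prod_(j < n) ((2 ^+ k)^-1 : R)%:E)%E.
    congr (_ * _)%E; first exact: haar_cylinder.
    apply: etrans (@power_measure_box _ _ _ mu n
      (fun j => cylinder k (nth 0 (val (c.2 j)))) (fun=> measurable_cylinder _ _)) _.
    by apply: eq_bigr => j _; exact: haar_cylinder.
  rewrite prodEFin -EFinM; congr _%:E.
  by rewrite prodr_const card_ord exprVn -exprM -invfM -exprD mulnC.
under eq_integral => x _.
  have -> : (G (trunc_config L k x))%:E = (\sum_c (G c * \1_(A c) x)%:E)%E.
    rewrite (bigD1 (trunc_config L k x))//= indicE mem_set// mulr1.
    rewrite big1 ?adde0// => c cx; rewrite indicE memNset ?mulr0//.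
    by move=> /= e; rewrite e eqxx in cx.
  over.
rewrite ge0_integral_sum//; last 2 first.
- by move=> c; apply/measurable_EFinP; exact: measurable_funM.
- by move=> c x _; rewrite lee_fin mulr_ge0// indicE.
rewrite mulr_sumr -sumEFin; apply: eq_bigr => c _.
rewrite (integralZl_indic _ (fun=> A c))//; last by rewrite ltNge G0.
rewrite mulrC EFinM integral_indic// setIT; congr (_ * _)%E; exact: muA.
Qed.

(** A section of [trunc_config], with zero digits past the truncation; through it [fmk] and [Dmx]
    can be evaluated on finite data. *)
Definition lift_config (L k n : nat)
    (c : {poly_L 'F_2} * {ffun 'I_n -> {poly_k 'F_2}}) :
    unitP * n.-tuple unitP :=
  (nth 0 (val c.1), [tuple (nth 0 (val (c.2 j)) : unitP) | j < n]).

(** The largest digit index of t read by [Dmx] is m + (k-1), so k + m digits suffice there, and k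
    digits for each eta_j. *)
Lemma Dmx_lift_trunc (n m k : nat) (x : unitP * n.-tuple unitP) :
  let x' := lift_config (trunc_config (k + m) k x) in
  Dmx m k x'.1 x'.2 = Dmx m k x.1 x.2.
Proof.
rewrite /Dmx; congr col_mx; apply/matrixP => i j; rewrite !mxE.
  rewrite [LHS]coef_trunc_npoly ifT//.
  by have := ltn_ord i; have := ltn_ord j; lia.
by rewrite tnth_mktuple ffunE [LHS]coef_trunc_npoly ltn_ord.
Qed.

Lemma fmk_lift_trunc (R : realType) (n m k : nat) (x : unitP * n.-tuple unitP) :
  let x' := lift_config (trunc_config (k + m) k x) in
  fmk R m k x'.1 x'.2 = fmk R m k x.1 x.2.
Proof. by rewrite /= !fmkE Dmx_lift_trunc. Qed.

(** * Matrices counted by Gamma, parametrised by configurations *)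

Lemma Dmx_lift_inj (n m k : nat) : (1 <= k)%N ->
  injective (fun c : {poly_(k + m) 'F_2} * {ffun 'I_n -> {poly_k 'F_2}} =>
    Dmx m k (lift_config c).1 (lift_config c).2).
Proof.
move=> k1 [a B] [a' B'] /eq_col_mx[/matrixP ea /matrixP eB]; congr (_, _).
  apply/npolyP => l; have [lL|Ll] := ltnP l (k + m); last first.
    by rewrite !big_coef_npoly.
  (* A position on the antidiagonal l, going down the first column and then along the last row. The
     first column exists because [k] is positive. *)
  have im : (minn l m < 1 + m)%N by lia.
  have jk : (l - minn l m < k)%N by lia.
  have := ea (Ordinal im) (Ordinal jk); rewrite !mxE /=.
  by rewrite (_ : minn l m + _ = l)%N//; lia.
apply/ffunP => j; apply/npolyP => l; have [lk|kl] := ltnP l k; last first.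
  by rewrite !big_coef_npoly.
by have := eB j (Ordinal lk); rewrite !mxE !tnth_mktuple.
Qed.

(** Configurations correspond bijectively to the matrices with persymmetric upper block.
    Surjectivity truncates any sequence that witnesses persymmetry. *)
Lemma GammaE (n m k i : nat) : (1 <= k)%N ->
  Gamma n m k i = #|[set c : {poly_(k + m) 'F_2} * {ffun 'I_n -> {poly_k 'F_2}} |
    \rank (Dmx m k (lift_config c).1 (lift_config c).2) == i]%SET|.
Proof.
move=> k1; rewrite -(card_imset _ (@Dmx_lift_inj n m k k1)).
apply: eq_card => M; rewrite inE; apply/andP/imsetP.
  move=> [/eqP rkM /asboolP[a Ma]].
  (* The rows of the lower block, padded with zeros. *)
  pose eta : n.-tuple unitP := [tuple ((fun l =>
    if insub l is Some l' then dsubmx M j l' else 0) : unitP) | j < n].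
  have ME : M = Dmx m k a eta.
    rewrite -[LHS]vsubmxK Ma; congr col_mx.
    by apply/matrixP => j l; rewrite !mxE tnth_mktuple valK !mxE.
  exists (trunc_config (k + m) k (a, eta)); last by rewrite Dmx_lift_trunc.
  by rewrite inE Dmx_lift_trunc -ME rkM.
move=> [c]; rewrite inE => rk ->; split=> //.
by apply/asboolP; exists (lift_config c).1; rewrite col_mxKu.
Qed.

(** * Powers of f and the solution count *)

Lemma size_mul_npoly (F : fieldType) (k r : nat) (Y : {poly_k F})
    (Z : {poly_(r.+1) F}) : (size (val Y * val Z)%R <= k + r)%N.
Proof.
rewrite (leq_trans (size_polyMleq _ _))// -subn1 leq_subLR addnCA add1n.
by apply: leq_add; exact: size_npoly.
Qed.

(** Distributing the product over j yields a single sum over triples (Y, Z, U), ready to be raised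
    to a power. The inner ranges k + m and k match the truncation lengths. *)
Lemma fmk_chi (R : realType) (n m k : nat) (t : unitP) (eta : n.-tuple unitP) :
  fmk R m k t eta =
  \sum_(w : {poly_k 'F_2} * {poly_(m.+1) 'F_2} * {ffun 'I_n -> {poly_1 'F_2}})
    chi R (\sum_(l < k + m) t l * (val w.1.1 * val w.1.2)`_l) *
    \prod_(j < n)
      chi R (\sum_(l < k) tnth eta j l * (val w.1.1 * val (w.2 j))`_l).
Proof.
rewrite -(pair_bigA _ (fun (YZ : {poly_k 'F_2} * {poly_(m.+1) 'F_2})
    (U : {ffun 'I_n -> {poly_1 'F_2}}) =>
  chi R (\sum_(l < k + m) t l * (val YZ.1 * val YZ.2)`_l) *
  \prod_(j < n) chi R (\sum_(l < k) tnth eta j l * (val YZ.1 * val (U j))`_l))).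
rewrite /fmk [LHS]pair_bigA; apply: eq_bigr => YZ _; rewrite -mulr_sumr.
rewrite (E_mulK _ _ (size_mul_npoly _ _)); congr (_ * _).
rewrite bigA_distr_bigA; apply: eq_bigr => U _; apply: eq_bigr => j _.
by rewrite (@E_mulK _ k)// -[k in (_ <= k)%N]addn0 size_mul_npoly.
Qed.

(** The sum factors over t and the eta_j, and orthogonality applies to each factor. The size bounds
    make vanishing of the tested coefficients equivalent to vanishing of the polynomial. *)
Lemma sum_config (R : realType) (n L k : nat) (p : {poly 'F_2})
    (r : 'I_n -> {poly 'F_2}) :
  (size p <= L)%N -> (forall j, size (r j) <= k)%N ->
  \sum_(c : {poly_L 'F_2} * {ffun 'I_n -> {poly_k 'F_2}})
    chi R (\sum_(l < L) (val c.1)`_l * p`_l) *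
    \prod_(j < n) chi R (\sum_(l < k) (val (c.2 j))`_l * (r j)`_l) =
  if (p == 0) && [forall j, r j == 0] then 2 ^+ (L + n * k) else 0.
Proof.
move=> pL rk.
have coef0 N (u : {poly 'F_2}) : (size u <= N)%N ->
    [forall i : 'I_N, u`_i == 0] = (u == 0).
  move=> uN; apply/forallP/eqP => [h|-> i]; last by rewrite coef0.
  apply/polyP => i; rewrite coef0; have [iN|Ni] := ltnP i N.
    exact/eqP/(h (Ordinal iN)).
  by rewrite nth_default// (leq_trans uN).
rewrite -(pair_bigA _ (fun (a : {poly_L 'F_2})
    (B : {ffun 'I_n -> {poly_k 'F_2}}) => chi R (\sum_(l < L) (val a)`_l * p`_l) *
    \prod_(j < n) chi R (\sum_(l < k) (val (B j))`_l * (r j)`_l))) /=.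
under eq_bigr do rewrite -mulr_sumr.
rewrite -mulr_suml (sum_chi_npoly R (fun l => p`_l)) coef0//.
case: eqP => _ /=; last by rewrite mul0r.
rewrite -(bigA_distr_bigA (fun j (b : {poly_k 'F_2}) =>
  chi R (\sum_(l < k) (val b)`_l * (r j)`_l))).
rewrite (eq_bigr (fun j => if r j == 0 then 2 ^+ k else 0)); last first.
  by move=> j _; rewrite (sum_chi_npoly R (fun l => (r j)`_l)) coef0.
case: ifPn => [/forallP r0|/forallPn[j /negPf rj]].
  under eq_bigr do rewrite r0.
  by rewrite prodr_const card_ord exprD mulnC exprM.
by rewrite (bigD1 j)//= rj mul0r mulr0.
Qed.

Lemma sum_fmkX (R : realType) (n m k q : nat) :
  \sum_(c : {poly_(k + m) 'F_2} * {ffun 'I_n -> {poly_k 'F_2}})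
    fmk R m k (lift_config c).1 (lift_config c).2 ^+ q =
  2 ^+ (k + m + n * k) * (Rq q n k m)%:R.
Proof.
pose W := ({poly_k 'F_2} * {poly_(m.+1) 'F_2} *
  {ffun 'I_n -> {poly_1 'F_2}})%type.
pose p (s : {ffun 'I_q -> W}) := \sum_i val (s i).1.1 * val (s i).1.2.
pose r (s : {ffun 'I_q -> W}) j := \sum_i val (s i).1.1 * val ((s i).2 j).
have pL s : (size (p s) <= k + m)%N.
  apply/(leq_trans (size_sum _ _ _))/bigmax_leqP => i _.
  exact: size_mul_npoly.
have rk s j : (size (r s j) <= k)%N.
  apply/(leq_trans (size_sum _ _ _))/bigmax_leqP => i _.
  by rewrite -[k in (_ <= k)%N]addn0 size_mul_npoly.
(* Multiplying characters over the q factors adds the polynomials, which produces the left-hand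
   sides of the system. *)
have chiM N (a : nat -> 'F_2) (F : 'I_q -> {poly 'F_2}) :
    \prod_i chi R (\sum_(l < N) a l * (F i)`_l) =
    chi R (\sum_(l < N) a l * (\sum_i F i)`_l).
  rewrite -chi_sum exchange_big; congr (chi R _); apply: eq_bigr => l _.
  by rewrite coef_sum mulr_sumr.
transitivity (\sum_(s : {ffun 'I_q -> W})
  \sum_(c : {poly_(k + m) 'F_2} * {ffun 'I_n -> {poly_k 'F_2}})
    chi R (\sum_(l < k + m) (val c.1)`_l * (p s)`_l) *
    \prod_(j < n) chi R (\sum_(l < k) (val (c.2 j))`_l * (r s j)`_l)).
  (* For a fixed configuration, the q-th power expands as a sum over q-tuples [s] of triples. *)
  rewrite exchange_big; apply: eq_bigr => c _.
  rewrite fmk_chi -[in LHS](card_ord q) -prodr_const bigA_distr_bigA.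
  apply: eq_bigr => s _; rewrite big_split chiM; congr (_ * _).
  rewrite exchange_big; apply: eq_bigr => j _.
  by rewrite -chiM tnth_mktuple.
under eq_bigr do rewrite sum_config//.
rewrite -big_mkcond sumr_const -[LHS]mulr_natr; congr (_ * _%:R).
by rewrite /Rq cardsE.
Qed.

(** * Grouping by rank, and the final identities *)

Lemma sum_fmkX_rank (R : realType) (n m k q : nat) : (1 <= k)%N ->
  \sum_(c : {poly_(k + m) 'F_2} * {ffun 'I_n -> {poly_k 'F_2}})
    fmk R m k (lift_config c).1 (lift_config c).2 ^+ q =
  2 ^+ (q * (k + m + n + 1)) *
  \sum_(0 <= i < (minn k (n + 1 + m)).+1)
    (Gamma n m k i)%:R * 2 ^ (- (i * q)%N%:Z).
Proof.
move=> k1; pose rk (c : {poly_(k + m) 'F_2} * {ffun 'I_n -> {poly_k 'F_2}}) :=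
  \rank (Dmx m k (lift_config c).1 (lift_config c).2).
have rk_lt c : (rk c < (minn k (n + 1 + m)).+1)%N.
  have := rank_leq_col (Dmx m k (lift_config c).1 (lift_config c).2).
  have := rank_leq_row (Dmx m k (lift_config c).1 (lift_config c).2).
  by rewrite -/(rk c); lia.
have fmkXE c : fmk R m k (lift_config c).1 (lift_config c).2 ^+ q =
    2 ^+ (q * (k + m + n + 1)) * 2 ^ (- (rk c * q)%N%:Z).
  rewrite fmkE -/(rk c) [LHS]exprnP exprz_exp [X in _ = X * _]exprnP -expfzDr ?pnatr_eq0//.
  by congr (_ ^ _); rewrite mulrBl !PoszM [q%:Z * _]mulrC.
under eq_bigr do rewrite fmkXE.
rewrite -mulr_sumr; congr (_ * _).
rewrite big_mkord; under [RHS]eq_bigr do rewrite GammaE// mulr_natl.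
(* The summand depends on [c] only through its rank, and [GammaE] has turned each Gamma into the
   size of a rank fibre. *)
rewrite (partition_big (fun c => Ordinal (rk_lt c)) predT)//=.
apply: eq_bigr => i _; rewrite cardsE -sumr_const.
by apply: eq_big => // c /eqP <-.
Qed.

Theorem theorem1p11 (R : realType) (mu : probability unitP R) (n k m q : nat) :
  is_haar mu -> (1 <= n)%N -> (1 <= k)%N -> (1 <= q)%N ->
  [/\ forall (t : unitP) (eta : n.-tuple unitP),
        fmk R m k t eta
        = 2 ^ ((k + m + n + 1)%N%:Z - (\rank (Dmx m k t eta))%:Z),
      ((Rq q n k m)%:R%:E
       = \int[mu \x power_measure mu n]_x (fmk R m k x.1 x.2 ^+ q)%:E)%E
    & (\int[mu \x power_measure mu n]_x (fmk R m k x.1 x.2 ^+ q)%:E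
       = (2 ^ ((q * (k + m + n + 1))%N%:Z - ((n + 1) * k + m)%N%:Z)
          * \sum_(0 <= i < (minn k (n + 1 + m)).+1)
              (Gamma n m k i)%:R * 2 ^ (- (i * q)%N%:Z))%:E)%E ].
Proof.
move=> mu_haar _ k1 _.
(* Both evaluations of the integral start from this average over configurations with k + m digits
   for t and k for each eta_j. *)
have intE : (\int[mu \x power_measure mu n]_x (fmk R m k x.1 x.2 ^+ q)%:E =
    ((2 ^+ (k + m + n * k))^-1 *
     \sum_(c : {poly_(k + m) 'F_2} * {ffun 'I_n -> {poly_k 'F_2}})
       fmk R m k (lift_config c).1 (lift_config c).2 ^+ q)%:E)%E.
  rewrite -(integral_trunc_config mu_haar); last first.
    by move=> c; rewrite fmkE exprn_ge0// exprz_ge0.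
  by apply: eq_integral => x _; rewrite fmk_lift_trunc.
have p2 : (2 ^+ (k + m + n * k) : R) != 0 by rewrite expf_neq0// pnatr_eq0.
split; first exact: fmkE; rewrite intE.
  by rewrite sum_fmkX mulKf.
rewrite sum_fmkX_rank// mulrA; congr (_ * _)%:E.
rewrite expfzDr ?pnatr_eq0// mulrC; congr (_ * _).
(* The number of digits k + m + nk is (n+1)k + m. *)
by rewrite -exprnN; congr (_ ^- _); lia.
Qed.
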